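(* There exists $n_0$ such that for every $n \ge n_0$ the following holds. Let $\mathcal{F}$ be a family of at least $2^{0.44n}$ subsets of $[n]$. Then there exist sets $A, B, C, D, E, F \in \mathcal{F}$ with $A \ne B$, $C \ne D$, $E \ne F$ such that the symmetric differences $A \triangle B$, $C \triangle D$ and $E \triangle F$ are pairwise disjoint.
   Context: $[n]=\{1,\dots,n\}$; $\triangle$ denotes symmetric difference of sets. *)

(* Defs.v *)
From mathcomp Require Import all_boot.
Set Implicit Arguments. Unset Strict Implicit. Unset Printing Implicit Defensive.

Definition symdiff (T : finType) (A B : {set T}) : {set T} := (A :\: B) :|: (B :\: A).

(* Main.v *)
(* By pigeonhole a family with more than 2^|S| members contains two sets that
   agree on S, and if it is larger, two close ones.  Taking S to be the union of the
   differences already found, it suffices that two successive close pairs use up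
   fewer than 0.44 n coordinates; the third pair then comes from the pigeonhole
   principle.  Closeness is given by the first linear programming bound for
   codes, proved as in Navon and Samorodnitsky: let f >= 0 be supported on a
   Hamming ball B and satisfy A f >= lam f for the adjacency operator A of the
   cube.  The characters diagonalise A with eigenvalue n - 2|y| at y, and
   positive definiteness of the distance distribution of a code C of minimum
   distance d gives |C| <= (n + 1) |B| as soon as lam + 2d >= n + 1. *)
Require Import Defs.
From mathcomp Require Import all_boot all_order all_algebra.
From mathcomp Require Import zify ring lra.
Import Order.TTheory GRing.Theory Num.Theory.
Set Implicit Arguments.
Unset Strict Implicit.
Unset Printing Implicit Defensive.

(** * Algebra of symmetric differences *)

Section Symdiff.
Variable T : finType.
Implicit Types A B : {set T}.

Lemma in_symdiff A B i : (i \in symdiff A B) = (i \in A) (+) (i \in B).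
Proof. by rewrite !inE; case: (i \in A); case: (i \in B). Qed.

Lemma symdiffK B : involutive (fun A => symdiff A B).
Proof. by move=> A; apply/setP => i; rewrite !in_symdiff addbK. Qed.

Lemma symdiff_eq0 A B : (symdiff A B == set0) = (A == B).
Proof.
apply/eqP/eqP => [/setP AB|->]; apply/setP => i; last by rewrite in_symdiff addbb inE.
by move: (AB i); rewrite in_symdiff inE; case: (i \in A); case: (i \in B).
Qed.

Lemma symdiffii A : symdiff A A = set0.
Proof. by apply/eqP; rewrite symdiff_eq0. Qed.
End Symdiff.

(** * Characters of the cube and the spectral code bound *)

Section Fourier.
Local Open Scope ring_scope.
Variables (R : realFieldType) (T : finType).
Implicit Types (x y : {set T}) (f g : {set T} -> R) (C : {set {set T}}).

(** The Walsh character (-1)^|x ∩ y|, as a product so that its laws can be checked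
    coordinatewise. *)
Definition chi x y : R := \prod_i (-1) ^+ ((i \in x) && (i \in y)).

Lemma chiC x y : chi x y = chi y x.
Proof. by apply: eq_bigr => i _; rewrite andbC. Qed.

Lemma chiDl x x' y : chi (symdiff x x') y = chi x y * chi x' y.
Proof.
rewrite -big_split; apply: eq_bigr => i _ /=.
by rewrite in_symdiff andb_addl signr_addb.
Qed.

Lemma chiDr x y y' : chi x (symdiff y y') = chi x y * chi x y'.
Proof. by rewrite chiC chiDl !(chiC x). Qed.

Lemma chi0r x : chi x set0 = 1.
Proof. by apply: big1 => i _; rewrite inE andbF. Qed.

Lemma chi1 i y : chi [set i] y = 1 - 2%:R * (i \in y)%:R.
Proof.
rewrite /chi (bigD1 i) //= big1 ?mulr1 => [|j /negPf jNi]; last by rewrite inE jNi.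
by rewrite inE eqxx; case: (i \in y) => /=; rewrite ?expr1 ?expr0; ring.
Qed.

Lemma sum_chi1 y : \sum_i chi [set i] y = #|T|%:R - 2%:R * #|y|%:R.
Proof.
under eq_bigr do rewrite chi1.
rewrite sumrB sumr_const -mulr_sumr; congr (_ - _ * _).
by rewrite -sum1_card natr_sum [RHS]big_mkcond; apply: eq_bigr => i _; case: (i \in y).
Qed.

Definition fourier f y : R := \sum_x f x * chi x y.

Definition adj f x : R := \sum_i f (symdiff x [set i]).

Lemma fourier_adj f y :
  fourier (adj f) y = (#|T|%:R - 2%:R * #|y|%:R) * fourier f y.
Proof.
rewrite /fourier /adj -sum_chi1 mulr_suml.
under eq_bigr do rewrite mulr_suml.
rewrite exchange_big; apply: eq_bigr => i _ /=.
rewrite (reindex_inj (inv_inj (symdiffK [set i]))) mulr_sumr.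
by apply: eq_bigr => x _ /=; rewrite symdiffK chiDl mulrA mulrC mulrA.
Qed.

(** As [chi] is multiplicative, the sums over [c] and [c'] separate into a square. For nonnegative
    [f] and [g] every term on the right is nonnegative and may be dropped. *)
Lemma fourier_psd f g C :
  \sum_(c in C) \sum_(c' in C) fourier f (symdiff c c') * fourier g (symdiff c c')
  = \sum_x \sum_x' f x * g x' * (\sum_(c in C) chi (symdiff x x') c) ^+ 2.
Proof.
have E c c' : fourier f (symdiff c c') * fourier g (symdiff c c') =
    \sum_x \sum_x' f x * g x' * (chi (symdiff x x') c * chi (symdiff x x') c').
  rewrite /fourier mulr_suml; apply: eq_bigr => x _; rewrite mulr_sumr.
  by apply: eq_bigr => x' _; rewrite !chiDl !chiDr; ring.
under eq_bigr do under eq_bigr do rewrite E.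
under eq_bigr do rewrite exchange_big /=.
rewrite exchange_big; apply: eq_bigr => x _ /=.
under eq_bigr do rewrite exchange_big /=.
rewrite exchange_big; apply: eq_bigr => x' _ /=.
rewrite expr2 mulr_suml mulr_sumr; apply: eq_bigr => c _.
by rewrite !mulr_sumr; apply: eq_bigr.
Qed.

Lemma sqr_sum_le (I : finType) (B : {set I}) (h : I -> R) :
  (\sum_(i in B) h i) ^+ 2 <= #|B|%:R * \sum_(i in B) h i ^+ 2.
Proof.
have -> : (\sum_(i in B) h i) ^+ 2 = \sum_(i in B) \sum_(j in B) h i * h j.
  by rewrite expr2 mulr_suml; apply: eq_bigr => i _; rewrite mulr_sumr.
have : \sum_(i in B) \sum_(j in B) h i * h j <=
       \sum_(i in B) \sum_(j in B) (h i ^+ 2 / 2%:R + h j ^+ 2 / 2%:R).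
  apply: ler_sum => i _; apply: ler_sum => j _.
  have := sqr_ge0 (h i - h j); nra.
move=> /le_trans; apply.
under eq_bigr do rewrite big_split /=.
rewrite big_split /= [X in _ + X]exchange_big /=.
rewrite -big_split /= le_eqVlt; apply/orP; left; apply/eqP.
by rewrite mulr_sumr; apply: eq_bigr => i _; rewrite !sumr_const -mulr_natl; field.
Qed.

(** The sum of [fh (symdiff c c') ^+ 2] over pairs from [C] is bounded above through the nonnegative
    residual [adj f - lam f], and below by the diagonal x = x' in [fourier_psd]. Cauchy-Schwarz on
    [B] compares the two bounds. *)
Lemma spectral_code_bound f (lam : R) (d : nat) (B C : {set {set T}}) :
    (forall x, 0 <= f x) -> (forall x, x \notin B -> f x = 0) ->
    (exists x, f x != 0) -> (forall x, lam * f x <= adj f x) -> 0 <= lam ->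
    #|T|.+1%:R <= lam + 2%:R * d%:R ->
    (forall c c', c \in C -> c' \in C -> c != c' -> (d <= #|symdiff c c'|)%N) ->
  (#|C| <= #|T|.+1 * #|B|)%N.
Proof.
move=> f_ge0 fB [x0 fx0] f_adj lam_ge0 le_d distC.
pose fh := fourier f.
have resE y : fourier (fun x => adj f x - lam * f x) y =
    (#|T|%:R - 2%:R * #|y|%:R - lam) * fh y.
  rewrite [RHS]mulrBl -fourier_adj /fh /fourier mulr_sumr -sumrB.
  by apply: eq_bigr => x _; ring.
have upper : \sum_(c in C) \sum_(c' in C) fh (symdiff c c') ^+ 2 <=
    #|C|%:R * (#|T|.+1%:R * fh set0 ^+ 2).
  have pos : 0 <= \sum_(c in C) \sum_(c' in C)
      fh (symdiff c c') * fourier (fun x => adj f x - lam * f x) (symdiff c c').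
    rewrite fourier_psd; apply: sumr_ge0 => x _; apply: sumr_ge0 => x' _.
    by rewrite mulr_ge0 ?sqr_ge0 // mulr_ge0 // subr_ge0.
  (* Adding the nonnegative form gives [fh y ^+ 2] the factor n + 1 - 2|y| - lam, which is at most 0
     for distinct codewords and at most n + 1 at y = [set0]. *)
  apply: le_trans (_ : \sum_(c in C) \sum_(c' in C) (fh (symdiff c c') ^+ 2 +
      fh (symdiff c c') * fourier (fun x => adj f x - lam * f x) (symdiff c c')) <= _).
    under [leRHS]eq_bigr do rewrite big_split /=.
    by rewrite big_split /= lerDl.
  rewrite mulr_natl -sumr_const; apply: ler_sum => c Cc.
  rewrite (bigD1 c) //= -[leRHS]addr0; apply: lerD; last first.
    apply: sumr_le0 => c' /andP[Cc' ncc'].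
    rewrite resE; set y := symdiff c c'.
    have le_dy : (d%:R : R) <= #|y|%:R by rewrite ler_nat distC // eq_sym.
    have := sqr_ge0 (fh y); move: le_d; rewrite -natr1 /y => le_d; nra.
  rewrite symdiffii resE cards0.
  have := sqr_ge0 (fh set0); rewrite -natr1; nra.
have lower : #|C|%:R ^+ 2 * \sum_x f x ^+ 2 <=
    \sum_(c in C) \sum_(c' in C) fh (symdiff c c') ^+ 2.
  under [leRHS]eq_bigr do under eq_bigr do rewrite expr2.
  rewrite fourier_psd mulr_sumr; apply: ler_sum => x _.
  rewrite (bigD1 x) //= symdiffii.
  under eq_bigr do rewrite chiC chi0r.
  rewrite sumr_const mulrC expr2 lerDl; apply: sumr_ge0 => x' _.
  by rewrite mulr_ge0 ?sqr_ge0 // mulr_ge0.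
have fh0 : fh set0 ^+ 2 <= #|B|%:R * \sum_x f x ^+ 2.
  have restr (h : R -> R) : h 0 = 0 -> \sum_x h (f x) = \sum_(x in B) h (f x).
    by move=> h0; rewrite [RHS]big_mkcond; apply: eq_bigr => x _; case: ifPn => // /fB ->.
  rewrite /fh /fourier; under eq_bigr do rewrite chi0r mulr1.
  rewrite (restr id) // (restr (fun u => u ^+ 2)) ?expr0n //; exact: sqr_sum_le.
have f2_gt0 : 0 < \sum_x f x ^+ 2.
  rewrite (bigD1 x0) //= ltr_pwDl ?sumr_ge0 // => [|x _]; last exact: sqr_ge0.
  by rewrite exprn_even_gt0.
have [C0|C_gt0] := posnP #|C|; first by rewrite C0.
rewrite -(ler_nat R) -(ler_pM2l (_ : 0 < #|C|%:R)) ?ltr0n //.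
rewrite -(ler_pM2r f2_gt0) -expr2; apply: le_trans lower _; apply: le_trans upper _.
by rewrite -mulrA ler_pM2l ?ltr0n // natrM -mulrA ler_pM2l ?ltr0n.
Qed.
End Fourier.

(** * Cardinalities and Hamming balls *)

Lemma superset_of_card (T : finType) (S : {set T}) (k : nat) :
  #|S| <= k <= #|T| -> exists2 S' : {set T}, S \subset S' & #|S'| = k.
Proof.
elim: k => [|k IHk] /andP[Sk kT]; first by exists S => //; lia.
have [<-|SNk] := eqVneq #|S| k.+1; first by exists S.
have [|S' SS' S'k] := IHk; first by lia.
have [i iNS'] : exists i, i \in ~: S'.
  by apply/card_gt0P; have := cardsC S'; lia.
exists (i |: S'); first exact: subset_trans SS' (subsetUr _ _).
by rewrite cardsU1 -in_setC iNS' S'k.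
Qed.

Lemma card_symdiff1 (T : finType) (x : {set T}) i :
  #|symdiff x [set i]| = if i \in x then #|x|.-1 else #|x|.+1.
Proof.
case: ifPn => xi.
  rewrite (cardsD1 i x) xi; congr #|pred_of_set _|; apply/setP => j.
  by rewrite in_symdiff !inE; case: eqVneq => [->|]; rewrite ?xi //= addbF.
have -> : symdiff x [set i] = i |: x.
  apply/setP => j; rewrite in_symdiff !inE.
  by case: eqVneq => [->|]; rewrite ?(negPf xi) //= addbF.
by rewrite cardsU1 xi.
Qed.

Section Ball.
Local Open Scope ring_scope.

(** Removing a point of x goes down a level, adding one goes up. At |x| = 0 the truncated
    predecessor has coefficient 0. *)
Lemma adj_card (R : realFieldType) (T : finType) (phi : nat -> R) (x : {set T}) :
  adj (fun y : {set T} => phi #|y|) x =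
  #|x|%:R * phi #|x|.-1 + (#|T| - #|x|)%:R * phi #|x|.+1.
Proof.
rewrite /adj; under eq_bigr do rewrite card_symdiff1.
rewrite (bigID (mem x)) /=; congr (_ + _).
  under eq_bigr => i -> do [].
  by rewrite sumr_const mulr_natl.
under eq_bigr => i /negPf -> do [].
rewrite sumr_const mulr_natl; congr (_ *+ _).
by rewrite -(cardC (mem x)) addKn.
Qed.

(* The test function is s ^ |x| times the discrete parabola j (K - j) with
   j = |x| - a, whose second difference is -2; the truncated subtractions make
   it vanish outside a < |x| < a + K. *)
Lemma ball_code_bound (T : finType) (C : {set {set T}}) (a K p s1 s2 d : nat) :
    (0 < s1)%N -> (0 < s2)%N -> (1 < K)%N -> (a + K <= #|T|)%N ->
    (p * s1 <= a * s2)%N -> (p * s2 <= (#|T| - (a + K)) * s1)%N ->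
    (#|T|.+1 * K.-1 <= 2 * d * K.-1 + 2 * p * K.-2)%N ->
    (forall c c', c \in C -> c' \in C -> c != c' -> (d <= #|symdiff c c'|)%N) ->
  (#|C| <= #|T|.+1 * #|[set x : {set T} | (#|x| <= a + K)%N]|)%N.
Proof.
move=> s1_gt0 s2_gt0 K_gt1 aKT le_a le_naK le_d distC.
pose s : rat := s1%:R / s2%:R.
have s1P : 0 < s1%:R :> rat by rewrite ltr0n.
have s2P : 0 < s2%:R :> rat by rewrite ltr0n.
have s_gt0 : 0 < s by rewrite divr_gt0.
pose u j : rat := (j * (K - j))%:R.
pose phi w : rat := s ^+ w * u (w - a)%N.
pose lam : rat := 2%:R * p%:R * K.-2%:R / K.-1%:R.
have K1P : 0 < K.-1%:R :> rat by rewrite ltr0n; lia.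
have phi_ge0 w : 0 <= phi w by rewrite mulr_ge0 ?ler0n // exprn_ge0 // ltW.
apply: (@spectral_code_bound rat T (fun x => phi #|x|) lam d) => //.
- move=> x; rewrite inE -ltnNge => ltx; rewrite /phi /u.
  by have -> : (K - (#|x| - a) = 0)%N by [lia]; rewrite muln0 mulr0.
- have [|x _ xa] := @superset_of_card T set0 a.+1; first by rewrite cards0; lia.
  exists x; rewrite xa /phi mulf_neq0 ?expf_neq0 ?gt_eqF //.
  by rewrite /u ltr0n; lia.
- move=> x; rewrite (adj_card phi).
  set w := #|x|; have w_leT : (w <= #|T|)%N by exact: max_card.
  have [out|/negPn/andP[aw waK]] := boolP (~~ (a < w < a + K)%N).
    have -> : phi w = 0.
      rewrite /phi /u; have [le|gt] := leqP w a.
        by have -> : (w - a = 0)%N by [lia]; rewrite mul0n mulr0.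
      by have -> : (K - (w - a) = 0)%N by [lia]; rewrite muln0 mulr0.
    by rewrite mulr0 addr_ge0 // mulr_ge0.
  have [j wj] : exists j, w = (a + j.+1)%N by exists (w - a).-1; lia.
  have jK : (j.+1 < K)%N by lia.
  rewrite {w}wj in aw waK w_leT *.
  rewrite /phi addnS /= -addnS.
  have -> : ((a + j.+1).+1 - a = j.+2)%N by lia.
  have -> : (a + j.+1 - a = j.+1)%N by lia.
  have -> : (a + j - a = j)%N by lia.
  (* With [s ^ |x|] factored out, the levels below and above both carry weight at least [p]; the
     slope [s] balances the two. *)
  have E1 : p%:R <= (a + j.+1)%:R / s :> rat.
    rewrite /s invf_div mulrA ler_pdivlMr // -!natrM ler_nat; nia.
  have E2 : p%:R <= (#|T| - (a + j.+1))%:R * s :> rat.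
    rewrite /s mulrA ler_pdivlMr // -!natrM ler_nat; nia.
  have u2 : u j + u j.+2 = 2%:R * u j.+1 - 2%:R.
    have -> : u j = (j%:R * (K%:R - j%:R)) :> rat by rewrite /u natrM natrB //; lia.
    rewrite /u !natrM !natrB //; last by lia.
    by rewrite -!natr1; ring.
  (* Inside its support the parabola is at least K - 1, so 2u - 2 is at least 2u (K - 2) / (K - 1);
     this dictates [lam]. *)
  have u1 : K.-1%:R <= u j.+1 by rewrite /u ler_nat; nia.
  have lamu : lam * u j.+1 <= p%:R * (u j + u j.+2).
    rewrite /lam mulrAC ler_pdivrMr // u2.
    have -> : K.-1%:R = K.-2%:R + 1 :> rat by rewrite natr1; congr _%:R; lia.
    have := ler0n rat p; move: u1.
    have -> : K.-1%:R = K.-2%:R + 1 :> rat by rewrite natr1; congr _%:R; lia.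
    nra.
  have sj_gt0 : 0 < s ^+ (a + j.+1) by rewrite exprn_gt0.
  have -> : s ^+ (a + j) = s ^+ (a + j.+1) / s by rewrite addnS exprSr mulfK ?gt_eqF.
  rewrite exprSr.
  apply: le_trans (_ : s ^+ (a + j.+1) * (p%:R * (u j + u j.+2)) <= _).
    by rewrite mulrCA ler_pM2l.
  rewrite mulrDr mulrDr; apply: lerD.
    have -> : (a + j.+1)%:R * (s ^+ (a + j.+1) / s * u j) =
      s ^+ (a + j.+1) * ((a + j.+1)%:R / s * u j) by ring.
    by rewrite ler_pM2l // ler_wpM2r // ler0n.
  have -> : (#|T| - (a + j.+1))%:R * (s ^+ (a + j.+1) * s * u j.+2) =
      s ^+ (a + j.+1) * ((#|T| - (a + j.+1))%:R * s * u j.+2) by ring.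
  by rewrite ler_pM2l // ler_wpM2r // ler0n.
- by rewrite divr_ge0 ?mulr_ge0 ?ler0n.
rewrite -(ler_pM2r K1P) mulrDl /lam divfK ?gt_eqF // addrC.
by rewrite -!natrM -natrD ler_nat.
Qed.
End Ball.

(* Chernoff bound: weigh each set x by b ^ (n - |x|). *)
Lemma card_ball_le (T : finType) (b r : nat) : 0 < b -> r <= #|T| ->
  #|[set x : {set T} | #|x| <= r]| * b ^ (#|T| - r) <= b.+1 ^ #|T|.
Proof.
move=> b_gt0 rT.
have -> : b.+1 ^ #|T| = \sum_(x : {set T}) b ^ (#|T| - #|x|).
  rewrite -addn1 expnDn.
  rewrite (partition_big (fun x : {set T} => inord #|x| : 'I_(#|T|.+1)) xpredT) //=.
  apply: eq_bigr => i _; rewrite exp1n muln1 -card_draws -sum_nat_const.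
  apply: esym; apply: eq_big => [x|x /eqP <-].
    by rewrite inE -val_eqE /= inordK // ltnS max_card.
  by rewrite inordK // ltnS max_card.
rewrite -sum_nat_const [leqRHS](bigID (mem [set x : {set T} | #|x| <= r])) /=.
apply: leq_trans (leq_addr _ _); apply: leq_sum => x; rewrite inE => xr.
by rewrite leq_pexp2l // leq_sub2l.
Qed.

(** * Pigeonhole and close pairs *)

Section Agree.
Variable T : finType.
Implicit Types (A B S : {set T}) (F G : {set {set T}}).

(** Pigeonhole on the traces [A :&: S], of which there are at most [2 ^ #|S|]. *)
Lemma agreeing_subfamily F S k : 2 ^ #|S| * k < #|F| ->
  exists2 G : {set {set T}}, G \subset F &
    k < #|G| /\ {in G &, forall A B, [disjoint symdiff A B & S]}.
Proof.
move=> F_large; pose fib P := [set A in F | A :&: S == P].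
have [/exists_inP[P _ kP]|] := boolP [exists P in powerset S, k < #|fib P|].
  exists (fib P); first by apply/subsetP => A; rewrite inE => /andP[].
  split=> // A B; rewrite !inE => /andP[_ /eqP/setP AP] /andP[_ /eqP/setP BP].
  rewrite disjoint_subset; apply/subsetP => i; rewrite in_symdiff inE /=.
  move: (AP i) (BP i); rewrite -BP !inE.
  by case: (i \in S); rewrite ?andbT // => -> _; rewrite addbb.
rewrite negb_exists_in => /forall_inP small.
suff : #|F| <= 2 ^ #|S| * k by rewrite leqNgt F_large.
rewrite -sum1_card (partition_big (fun A => A :&: S) (mem (powerset S))) /=; last first.
  by move=> A _; rewrite powersetE subsetIr.
rewrite -card_powerset -sum_nat_const; apply: leq_sum => P /small.
rewrite -leqNgt; apply: leq_trans; rewrite -sum1_card.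
by apply/eq_leq/eq_bigl => A; rewrite inE.
Qed.

(** A subfamily agreeing on [S] becomes a code in the cube on the complement, too large for minimum
    distance d + 1. The last hypothesis is this size condition with the ball volume replaced by its
    Chernoff bound. *)
Lemma close_pair F S (a K p s1 s2 d b : nat) (m := #|~: S|) :
    0 < s1 -> 0 < s2 -> 1 < K -> a + K <= m ->
    p * s1 <= a * s2 -> p * s2 <= (m - (a + K)) * s1 ->
    m.+1 * K.-1 <= 2 * d.+1 * K.-1 + 2 * p * K.-2 -> 0 < b ->
    2 ^ #|S| * (m.+1 * b.+1 ^ m) < #|F| * b ^ (m - (a + K)) ->
  exists A B, [/\ A \in F, B \in F, A != B, #|symdiff A B| <= d
                & [disjoint symdiff A B & S]].
Proof.
move=> s1_gt0 s2_gt0 K_gt1 aKm le_a le_m le_d b_gt0 F_large.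
pose U := {i : T | i \in ~: S}.
have cardU : #|{: U}| = m by rewrite card_sig.
pose V := #|[set x : {set U} | #|x| <= a + K]|.
have [G GF [G_large G_agree]] : exists2 G : {set {set T}}, G \subset F &
    m.+1 * V < #|G| /\ {in G &, forall A B, [disjoint symdiff A B & S]}.
  apply: agreeing_subfamily.
  have b_pow : 0 < b ^ (m - (a + K)) by rewrite expn_gt0 b_gt0.
  rewrite -(ltn_pmul2r b_pow); apply: leq_ltn_trans F_large.
  rewrite -!mulnA !leq_mul2l -{2 3}cardU card_ball_le ?cardU //.
  by rewrite !orbT.
pose h A := [set i : U | val i \in A].
(* Members of [G] differ only outside [S], so restriction preserves distances. *)
have card_h : {in G &, forall A B, #|symdiff (h A) (h B)| = #|symdiff A B|}.
  move=> A B AG BG; rewrite -(card_imset _ val_inj); congr #|pred_of_set _|.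
  apply/setP => i; apply/imsetP/idP => [[j jAB ->]|iAB].
    by move: jAB; rewrite !in_symdiff !inE.
  have iS : i \in ~: S by rewrite inE (disjointFr (G_agree A B AG BG) iAB).
  by exists (Sub i iS); rewrite ?SubK // in_symdiff !inE /= -in_symdiff.
have h_inj : {in G &, injective h}.
  move=> A B AG BG /eqP; rewrite -symdiff_eq0 -cards_eq0 card_h // cards_eq0.
  by rewrite symdiff_eq0 => /eqP.
have [/exists_inP[A AG /exists_inP[B BG /andP[AB le_AB]]]|far] :=
    boolP [exists A in G, exists B in G, (A != B) && (#|symdiff A B| <= d)].
  by exists A, B; split=> //; [exact: subsetP GF A AG|exact: subsetP GF B BG|exact: G_agree].
suff : #|G| <= m.+1 * V by rewrite leqNgt G_large.
rewrite -(card_in_imset h_inj) -cardU.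
apply: (@ball_code_bound _ _ a K p s1 s2 d.+1); rewrite ?cardU //.
move=> _ _ /imsetP[A AG ->] /imsetP[B BG ->] neq; rewrite card_h // ltnNge.
apply: contra far => le_AB; apply/exists_inP; exists A => //.
by apply/exists_inP; exists B; rewrite // le_AB andbT; apply: contra neq => /eqP->.
Qed.
End Agree.

(** * Numerical estimates *)

Lemma leq_expn2r x y N : x <= y -> x ^ N <= y ^ N.
Proof. by case: N => [|N]; rewrite ?expn0 // leq_exp2r. Qed.

(** The slack v / u between x and y z, raised to the power k, pays for the constant c. *)
Lemma pow_gain c u v x y z k :
  0 < u -> c * u ^ k <= v ^ k -> v * x <= u * (y * z) ->
  c * x ^ k <= y ^ k * z ^ k.
Proof.
move=> u_gt0 cuv vxuy.
have uk_gt0 : 0 < u ^ k by rewrite expn_gt0 u_gt0.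
rewrite -(leq_pmul2l uk_gt0) -!expnMn.
apply: leq_trans (leq_expn2r k vxuy).
by rewrite mulnA expnMn leq_mul2r mulnC cuv orbT.
Qed.

Lemma leq_pow_scale c x y z e f g N :
  c * x ^ e <= y ^ f * z ^ g ->
  c ^ N * x ^ (e * N) <= y ^ (f * N) * z ^ (g * N).
Proof. by move=> /(leq_expn2r N); rewrite !expnMn -!expnM. Qed.

Lemma leq_mul4 x y z u v w :
  2 * x <= y * z -> 2 * u <= v * w -> 4 * (x * u) <= y * v * (z * w).
Proof. by move=> xyz uvw; rewrite mulnACA -[4]/(2 * 2) mulnACA leq_mul. Qed.

(* With logarithms in base 2, 11 H(1/11) = 11 log 11 - 10 log 10 < 4.84. *)
Lemma entropy_bound1 N :
  4 ^ N * 11 ^ (4400 * N) <= 2 ^ (1936 * N) * 10 ^ (4000 * N).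
Proof.
have E1 : 275 * 16 * N = 4400 * N by lia.
have E2 : 121 * 16 * N = 1936 * N by lia.
have E3 : 250 * 16 * N = 4000 * N by lia.
rewrite -E1 -E2 -E3; apply: leq_pow_scale.
rewrite (expnM 11 275 16) (expnM 2 121 16) (expnM 10 250 16).
(* The factor 4 comes from 4 <= (11/10)^16. *)
apply: (@pow_gain 4 10 11 (11 ^ 275) (2 ^ 121) (10 ^ 250) 16); lia.
Qed.

(* 3460 H(1/20) = 3460 log 20 - 3287 log 19 < 994. *)
Lemma entropy_bound2 N :
  4 ^ N * 20 ^ (3460 * N) <= 2 ^ (996 * N) * 19 ^ (3287 * N).
Proof.
(* Splitting the exponents keeps the numerals small; the 43rd power and the remainder contribute a
   factor 2 each. *)
have E1 : (80 * 43 + 20) * N = 3460 * N by lia.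
have E2 : (23 * 43 + 7) * N = 996 * N by lia.
have E3 : (76 * 43 + 19) * N = 3287 * N by lia.
have H1 : 2 * (20 ^ 80) ^ 43 <= (2 ^ 23) ^ 43 * (19 ^ 76) ^ 43.
  apply: (@pow_gain 2 16 17 (20 ^ 80) (2 ^ 23) (19 ^ 76) 43); lia.
have H2 : 2 * 20 ^ 20 <= 2 ^ 7 * 19 ^ 19 by clear; lia.
rewrite -E1 -E2 -E3; apply: leq_pow_scale.
rewrite (expnD 20 (80 * 43) 20) (expnM 20 80 43) (expnD 2 (23 * 43) 7).
rewrite (expnM 2 23 43) (expnD 19 (76 * 43) 19) (expnM 19 76 43).
exact: leq_mul4 H1 H2.
Qed.
(** The spare [4 ^ N] of the entropy bounds absorbs the leftover coordinates and the factor m +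
    1. *)
Lemma linear_lt_exp c e s N :
  c < 2 ^ e -> s + e < N -> 2 ^ s * (c * N).+1 < 4 ^ N.
Proof.
move=> c_lt seN; have lin : (c * N).+1 <= 2 ^ e * 2 ^ N.
  have N_lt : N < 2 ^ N by rewrite ltn_expl.
  by move: (2 ^ e) (2 ^ N) c_lt N_lt => x y; nia.
apply: leq_ltn_trans (_ : 2 ^ (s + e) * 2 ^ N < _).
  by rewrite expnD -mulnA leq_mul2l lin orbT.
by rewrite -[4]/(2 * 2) expnMn ltn_pmul2r ?ltn_exp2l // expn_gt0.
Qed.

Lemma size_bound s e f M P Q N X :
  2 ^ s * M < 4 ^ N -> 0 < P -> 4 ^ N * P <= 2 ^ f * Q -> 2 ^ (e + f) <= X ->
  2 ^ (s + e) * (M * P) < X * Q.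
Proof.
move=> sM P_gt0 PQ eX.
apply: leq_trans (_ : 2 ^ e * (4 ^ N * P) <= _).
  have -> : 2 ^ (s + e) * (M * P) = 2 ^ e * (2 ^ s * M * P) by rewrite expnD; ring.
  by rewrite ltn_pmul2l ?expn_gt0 // ltn_pmul2r.
apply: leq_trans (_ : 2 ^ e * (2 ^ f * Q) <= _); first by rewrite leq_mul2l PQ orbT.
by rewrite mulnA -expnD leq_mul2r eX orbT.
Qed.
(* The first pair uses the ball of radius n / 11 and differs in at most
   940 N = 0.2137 n places, the second uses the ball of radius m / 20 in the
   remaining m = 3460 N coordinates and differs in at most 995 N places, and
   940 + 995 < 1936 = 0.44 * 4400.  The slopes 6/19 and 3/13 approximate
   sqrt (1/10) and sqrt (1/19). *)
Lemma three_close_pairs (T : finType) (F : {set {set T}}) (s N : nat) :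
    s < 4400 -> 4500 <= N -> #|T| = 4400 * N + s -> 2 ^ (1936 * N) <= #|F| ->
  exists A B C D E G : {set T},
    [/\ A \in F, B \in F, C \in F & D \in F] /\ E \in F /\ G \in F /\
    [/\ A != B, C != D & E != G] /\
    [/\ [disjoint symdiff A B & symdiff C D],
        [disjoint symdiff A B & symdiff E G] &
        [disjoint symdiff C D & symdiff E G]].
Proof.
move=> s_lt N_ge cardT F_large.
have sN : s + 13 < N by lia.
have pow13 : 4400 < 2 ^ 13 by lia.
have growth := linear_lt_exp pow13 sN.
(* Freezing the [s] leftover coordinates makes the dimension exactly 4400 N. *)
have [|S0 _ S0_card] := @superset_of_card T set0 s; first by rewrite cards0; lia.
have m1 : #|~: S0| = 4400 * N by have := cardsC S0; lia.
(* 1263 N lies just below sqrt (400 * 4000) N, and a parabola of width 500 loses only 1/499 of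
   [lam]. *)
have [| | | | | | | | |A [B [AF BF AB AB_card AB_S]]] :=
  @close_pair T F S0 (400 * N - 500) 500 (1263 * N) 6 19 (940 * N) 10;
  rewrite ?m1; try lia.
  have -> : 4400 * N - (400 * N - 500 + 500) = 4000 * N by lia.
  rewrite S0_card -[s]addn0; apply: size_bound growth _ (entropy_bound1 N) _ => //.
  by rewrite expn_gt0.
(* Padding to an exact size fixes the next dimension at 3460 N. *)
have [|S1 S01 S1_card] := @superset_of_card T (S0 :|: symdiff A B) (s + 940 * N).
  have := cardsU S0 (symdiff A B); clear -S0_card AB_card cardT N_ge; lia.
have m2 : #|~: S1| = 3460 * N by have := cardsC S1; lia.
have [| | | | | | | | |C [D [CF DF CD CD_card CD_S]]] :=
  @close_pair T F S1 (173 * N - 500) 500 (740 * N) 3 13 (995 * N) 19;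
  rewrite ?m2; try lia.
  have -> : 3460 * N - (173 * N - 500 + 500) = 3287 * N by lia.
  rewrite S1_card; apply: size_bound (entropy_bound2 N) _.
  - apply: leq_ltn_trans growth; rewrite leq_mul2l; lia.
  - by rewrite expn_gt0.
  - by have -> : 940 * N + 996 * N = 1936 * N by lia.
have [|S2 S12 S2_card] := @superset_of_card T (S1 :|: symdiff C D) (s + 1935 * N).
  have := cardsU S1 (symdiff C D); clear -S1_card CD_card cardT N_ge; lia.
(* As s < N, s + 1935 N < 1936 N, so two members agree on [S2]. *)
have [|H HF [H_large H_agree]] := @agreeing_subfamily T F S2 1.
  rewrite muln1 S2_card; apply: leq_trans F_large.
  by rewrite (ltn_exp2l _ _ (isT : 1 < 2)); clear -sN; lia.
have /card_gt1P[E [G [EH GH EG]]] := H_large.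
have EG_S2 := H_agree E G EH GH.
have sub1 : symdiff A B \subset S1 by apply: subset_trans S01; rewrite subsetUr.
have sub2 : S1 \subset S2 by apply: subset_trans S12; rewrite subsetUl.
have sub3 : symdiff C D \subset S2 by apply: subset_trans S12; rewrite subsetUr.
have EF := subsetP HF E EH; have GF := subsetP HF G GH.
clear - AF BF CF DF EF GF AB CD EG CD_S EG_S2 sub1 sub2 sub3.
exists A, B, C, D, E, G; do !split => //.
- by rewrite disjoint_sym; apply: disjointWr sub1 CD_S.
- by rewrite disjoint_sym; apply: disjointWr (subset_trans sub1 sub2) EG_S2.
- by rewrite disjoint_sym; apply: disjointWr sub3 EG_S2.
Qed.

(* Ground set [n] is modeled by 'I_n. |F| >= 2^(0.44 n) = 2^(11n/25) is
   written exactly as |F|^25 >= 2^(11 n). *)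
Theorem theorem4p1 :
  exists n0 : nat, forall n : nat, n0 <= n ->
  forall F : {set {set 'I_n}}, 2 ^ (11 * n) <= #|F| ^ 25 ->
  exists A B C D E G : {set 'I_n},
    [/\ A \in F, B \in F, C \in F & D \in F] /\ E \in F /\ G \in F /\
    [/\ A != B, C != D & E != G] /\
    [/\ [disjoint symdiff A B & symdiff C D],
        [disjoint symdiff A B & symdiff E G] &
        [disjoint symdiff C D & symdiff E G]].
Proof.
(* This gives N >= 4500, hence s + 13 < N for every remainder s. *)
exists (4400 * 4500) => n n_ge F F_large.
have n_eq : n = 4400 * (n %/ 4400) + n %% 4400 by rewrite mulnC -divn_eq.
have s_lt : n %% 4400 < 4400 by rewrite ltn_mod.
apply: (@three_close_pairs _ F (n %% 4400) (n %/ 4400)); rewrite ?card_ord //.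
  by rewrite leq_divRL 1?mulnC.
(* Here 25 * 1936 = 11 * 4400. *)
rewrite -(@leq_exp2r _ _ 25 isT) -expnM; apply: leq_trans F_large.
by rewrite (leq_exp2l _ _ (isT : 1 < 2)); clear -n_eq; lia.
Qed.
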